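(* Let $a,d$ be positive integers with $\gcd(a,d)=1$, let $k$ be an integer with $1\le k\le a-1$, let $S=\langle a,a+d,\dots,a+kd\rangle$, and write $a=qk+r$ with integers $q$ and $0\le r<k$. Let $x\in\mathbb{Z}\setminus\{0,\ a,\ a+kd,\ a+(a+kd)\}$. Then: if $r=0$, $$\mu_S(x)=\mu_S(x-q(a+kd))+\sum_{i=1}^{k-1}\Big(\mu_S(x-(a+id)-q(a+kd))-\mu_S(x-(a+id))\Big);$$ if $r=1$, $$\mu_S(x)=\mu_S(x-(q+1)(a+kd))+\sum_{i=r}^{k-1}\mu_S(x-(a+id)-q(a+kd))-\sum_{i=1}^{k-1}\mu_S(x-(a+id));$$ if $r\ge2$, $$\mu_S(x)=\mu_S(x-(q+1)(a+kd))+\sum_{i=1}^{r-1}\mu_S(x-(a+id)-(q+1)(a+kd))+\sum_{i=r}^{k-1}\mu_S(x-(a+id)-q(a+kd))-\sum_{i=1}^{k-1}\mu_S(x-(a+id)).$$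
   Context: $S=\langle a,a+d,\dots,a+kd\rangle=\{\sum_{j=0}^k y_j(a+jd):y_j\in\mathbb{N}\}$, a numerical semigroup. The poset $(\mathbb{Z},\leq_S)$ is given by $x\leq_S y$ iff $y-x\in S$. Its M\''obius function satisfies $\mu_S(x,x)=1$, $\mu_S(x,y)=-\sum_{z:\,x\leq_S z<_S y}\mu_S(x,z)$ for $x<_S y$, and $\mu_S(x,y)=0$ if $x\not\leq_S y$. The reduced M\''obius function is $\mu_S(x):=\mu_S(0,x)$ for $x\in\mathbb{Z}$ (so $\mu_S(x)=0$ for $x\notin S$). *)

(* Defs.v *)
From mathcomp Require Import all_boot all_order all_algebra.
From mathcomp Require Import boolp classical_sets functions cardinality fsbigop.
From mathcomp Require Import zify.

Set Implicit Arguments.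
Unset Strict Implicit.
Unset Printing Implicit Defensive.

Import Order.TTheory GRing.Theory Num.Theory.

Local Open Scope classical_set_scope.
Local Open Scope ring_scope.

Definition arith_semigroup (a d k : nat) : set int :=
  [set x | exists y : 'I_k.+1 -> nat,
             x = (\sum_(j < k.+1) y j * (a + j * d))%N%:Z].

Definition leS (S : set int) (x y : int) : bool := (y - x) \in S.
Definition ltS (S : set int) (x y : int) : bool := leS S x y && (x != y).

(* The natural number n is only recursion fuel: when S contains no negative
   integer, x <=_S z <_S y implies `|z - x| < `|y - x|, so that any
   n > `|y - x| gives the same value (moebius_fuelE below). *)
Fixpoint moebius_fuel (S : set int) (n : nat) (x y : int) : int :=
  if n is n'.+1 then
    if x == y then 1
    else if leS S x y then
      - \sum_(z \in [set z | leS S x z && ltS S z y]) moebius_fuel S n' x z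
    else 0
  else 0.

Definition moebius (S : set int) (x y : int) : int :=
  moebius_fuel S `|y - x|.+1 x y.

Definition rmoebius (S : set int) (x : int) : int := moebius S 0 x.

Lemma arith_semigroup_ge0 a d k x : arith_semigroup a d k x -> 0 <= x.
Proof. by case=> y ->. Qed.

Section Moebius.
Variable S : set int.
Hypothesis S_ge0 : forall x, S x -> 0 <= x.

Lemma leS_le x y : leS S x y -> x <= y.
Proof. by rewrite /leS inE => /S_ge0; rewrite subr_ge0. Qed.

Lemma ltS_lt x y : ltS S x y -> x < y.
Proof. by case/andP=> /leS_le xy nxy; rewrite lt_neqAle nxy. Qed.

Lemma finite_intervalS x y : finite_set [set z | leS S x z && ltS S z y].
Proof.
apply: (@sub_finite_set _ _ ((fun i : nat => x + i%:Z) @` `I_(`|y - x|%N))).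
  move=> z /= /andP[/leS_le xz /ltS_lt zy].
  by exists `|z - x|%N => /=; lia.
exact/finite_image/finite_II.
Qed.

Lemma moebius_fuelE m n x y : (`|y - x| < m)%N -> (`|y - x| < n)%N ->
  moebius_fuel S m x y = moebius_fuel S n x y.
Proof.
elim: m n x y => // m IH [//|n] x y /= hm hn.
case: eqP => // _; case: ifP => // _; congr (- _).
apply: eq_fsbigr => z; rewrite inE /= => /andP[/leS_le xz /ltS_lt zy].
by apply: IH; lia.
Qed.

Lemma moebius_refl x : moebius S x x = 1.
Proof. by rewrite /moebius /= eqxx. Qed.

Lemma moebius_lt x y : ltS S x y ->
  moebius S x y = - \sum_(z \in [set z | leS S x z && ltS S z y]) moebius S x z.
Proof.
case/andP=> xy nxy; rewrite {1}/moebius /= (negbTE nxy) xy; congr (- _).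
apply: eq_fsbigr => z; rewrite inE /= => /andP[/leS_le xz /ltS_lt zy].
by apply: moebius_fuelE; lia.
Qed.

Lemma moebius_nle x y : S 0 -> ~~ leS S x y -> moebius S x y = 0.
Proof.
move=> S0 nxy; rewrite /moebius /= (negbTE nxy); case: eqP => // xy.
by case/negP: nxy; rewrite xy /leS subrr inE.
Qed.

End Moebius.

Lemma arith_semigroup0 a d k : arith_semigroup a d k 0.
Proof. by exists (fun=> 0%N); rewrite big1. Qed.

(* Main.v *)
Require Import Defs.
From mathcomp Require Import all_boot all_order all_algebra.
From mathcomp Require Import classical_sets.
From mathcomp Require Import fsbigop.
From mathcomp Require Import zify ring.

Import Order.TTheory GRing.Theory Num.Theory.
Local Open Scope ring_scope.

(** With [S] the semigroup and [w j = ceil(j/k) a + j d], the elements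
    [w 0, ..., w (a-1)] form the Apery set of [S] with respect to [a], so that
    [(1 - t^a) H_S(t) = sum_(j < a) t^(w j)].  Since [w (j + k) = w j + (a + k d)],
    multiplying by [1 - t^(a + k d)] telescopes this to
    [P(t) = sum_(j < k) t^(w j) - sum_(a <= j < a + k) t^(w j)].  The generating
    function of the reduced Moebius function is [1 / H_S], hence its product
    with [P] is [(1 - t^a) (1 - t^(a + k d))], whose coefficients vanish away
    from the four excluded values of [x]. *)

(** * Membership in the semigroup *)

Lemma arith_semigroupD (a d k : nat) (x y : int) :
  arith_semigroup a d k x -> arith_semigroup a d k y ->
  arith_semigroup a d k (x + y).
Proof.
move=> [u ->] [v ->]; exists (fun j => u j + v j)%N.
by rewrite -PoszD -big_split /=; congr Posz; apply: eq_bigr => j _; rewrite mulnDl.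
Qed.

Lemma arith_semigroup_gen (a d k i : nat) : (i <= k)%N ->
  arith_semigroup a d k (a + i * d)%N.
Proof.
rewrite -ltnS => ik; exists (fun j => (j == Ordinal ik) : nat).
rewrite (bigD1 (Ordinal ik)) //= eqxx mul1n big1 ?addn0 // => j /negbTE ->.
by rewrite mul0n.
Qed.

(** Here [m] counts the generators used and [j] adds up their indices. Conversely, one peels off the
    generator of index [minn j k], which leaves an index total of at most [(m - 1) * k]. *)
Lemma arith_semigroupP (a d k : nat) (x : int) :
  arith_semigroup a d k x <->
  exists m j : nat, (j <= m * k)%N /\ x = (m * a + j * d)%N%:Z.
Proof.
split=> [[y ->]|[m [j [jmk ->]]]].
  exists (\sum_(j < k.+1) y j)%N, (\sum_(j < k.+1) y j * j)%N; split.
    by rewrite big_distrl leq_sum // => j _; rewrite leq_mul2l -ltnS ltn_ord orbT.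
  congr Posz; rewrite !big_distrl -big_split /=; apply: eq_bigr => j _.
  by rewrite mulnDr mulnA.
elim: m j jmk => [|m IH] j jmk.
  have -> : j = 0%N by lia.
  exact: arith_semigroup0.
have -> : (m.+1 * a + j * d)%N%:Z
    = (a + minn j k * d)%N%:Z + (m * a + (j - minn j k) * d)%N%:Z.
  rewrite -PoszD; congr Posz; have : (minn j k <= j)%N by exact: geq_minl.
  by move=> /subnKC {1}<-; rewrite mulSn mulnDl; lia.
apply: arith_semigroupD; first exact/arith_semigroup_gen/geq_minr.
by apply: IH; lia.
Qed.

(** * Candidate Apery elements *)

Definition ceil_div (j k : nat) : nat := ((j + k.-1) %/ k)%N.

Lemma ceil_div_le (j k m : nat) : (0 < k)%N ->
  (ceil_div j k <= m)%N = (j <= m * k)%N.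
Proof. by move=> k_gt0; rewrite /ceil_div -ltnS ltn_divLR // mulSn; lia. Qed.

Lemma ceil_divD (j k : nat) : (0 < k)%N -> ceil_div (j + k) k = (ceil_div j k).+1.
Proof.
by move=> k0; rewrite /ceil_div addnAC divnDr // divnn k0 addn1.
Qed.

Definition apery (a d k j : nat) : int := (ceil_div j k * a + j * d)%N%:Z.

Lemma apery0 (a d k : nat) : (0 < k)%N -> apery a d k 0 = 0.
Proof.
by move=> k0; rewrite /apery /ceil_div add0n divn_small ?prednK.
Qed.

(** The ceiling of [i / k] is 1 on this range; this is how the generators enter the final
    recurrences. *)
Lemma apery_gen (a d k i : nat) : (0 < i <= k)%N ->
  apery a d k i = (a + i * d)%N%:Z.
Proof.
case/andP=> i0 ik; rewrite /apery; suff -> : ceil_div i k = 1%N by rewrite mul1n.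
have k0 : (0 < k)%N by exact: leq_trans ik.
by apply/eqP; rewrite eqn_leq ceil_div_le // mul1n ik ltnNge ceil_div_le // -ltnNge.
Qed.

Lemma aperyD (a d k m j : nat) : (0 < k)%N ->
  apery a d k (m * k + j) = apery a d k j + m%:Z * (a + k * d)%N%:Z.
Proof.
move=> k0; elim: m => [|m IH]; first by rewrite mul0r addr0.
rewrite mulSn -addnA addnC -[m.+1]add1n PoszD mulrDl mul1r addrCA -IH.
rewrite /apery ceil_divD // mulSn !mulnDl -PoszD; congr Posz; lia.
Qed.

(** * Residue classes modulo [a] and the Hilbert series numerator *)

Section Residue.
Variables a d k : nat.
Hypotheses (a_gt0 : (0 < a)%N) (k_gt0 : (0 < k)%N) (cop : coprime a d).

Lemma residue_uniq (i j : nat) (s t : int) : (i < a)%N -> (j < a)%N ->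
  s * a%:Z + i%:Z * d%:Z = t * a%:Z + j%:Z * d%:Z -> i = j.
Proof.
move=> ia ja e.
have dv : (a%:Z %| (i%:Z - j%:Z))%Z.
  rewrite -(@Gauss_dvdzl _ _ d%:Z); last by rewrite coprimezE.
  apply/dvdzP; exists (t - s); lia.
have : (i%:Z == j%:Z %[mod a%:Z])%Z by rewrite eqz_mod_dvd.
by rewrite !modz_nat !modn_small // => /eqP [].
Qed.

(** By Bezout [x = x * u * a + x * v * d]; reducing [x * v] modulo [a] gives [j], and the quotient
    goes into [t]. *)
Lemma residue_exists (x : int) :
  exists (j : nat) (t : int), (j < a)%N /\ x = t * a%:Z + j%:Z * d%:Z.
Proof.
have /coprimezP[[u v] /= uv] : coprimez a%:Z d%:Z by rewrite coprimezE.
have a0 : a%:Z != 0 by lia.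
have := modz_ge0 (x * v) a0; have := ltz_pmod (x * v) (d := a%:Z).
have := divz_eq (x * v) a%:Z.
set j := (_ %% _)%Z; set c := (_ %/ _)%Z => e /(_ _) jlt jge.
exists `|j|%N, (x * u + c * d%:Z); split; first by lia.
rewrite gez0_abs // -{1}[x]mulr1 -uv mulrDr !mulrA e; ring.
Qed.

(** If [m * a + i * d] with [i <= m * k] represents the element, then [j = i %% a] and
    [t = m + (i %/ a) * d], so [j <= i <= m * k <= t * k]. *)
Lemma arith_semigroup_residue (j : nat) (t : int) : (j < a)%N ->
  (t * a%:Z + j%:Z * d%:Z \in arith_semigroup a d k) = ((ceil_div j k)%:Z <= t).
Proof.
move=> ja; apply/idP/idP => [|jt].
  rewrite inE => /arith_semigroupP [m [i [imk e]]].
  have ij : (i %% a)%N = j.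
    apply: (@residue_uniq _ _ (m + i %/ a * d)%N%:Z t); rewrite ?ltn_mod // e.
    rewrite {3}(divn_eq i a) -!PoszM -!PoszD; congr Posz; lia.
  have te : t = (m + i %/ a * d)%N%:Z.
    apply: (@mulIf _ a%:Z); first by lia.
    apply: (@addIr _ (j%:Z * d%:Z)); rewrite e {1}(divn_eq i a) ij.
    rewrite -!PoszM -!PoszD; congr Posz; lia.
  rewrite te lez_nat ceil_div_le //; apply: leq_trans (_ : i <= _)%N.
    by rewrite -ij leq_mod.
  by rewrite mulnDl (leq_trans imk) ?leq_addr.
rewrite inE; apply/arith_semigroupP; exists `|t|%N, j.
by split; [rewrite -ceil_div_le //; lia|rewrite PoszD !PoszM gez0_abs //; lia].
Qed.

Lemma arith_semigroup_apery (x : int) :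
  (x \in arith_semigroup a d k)%:R - (x - a%:Z \in arith_semigroup a d k)%:R
  = \sum_(j < a) (x == apery a d k j)%:R :> int.
Proof.
have [j [t [ja ->]]] := residue_exists x.
have -> : t * a%:Z + j%:Z * d%:Z - a%:Z = (t - 1) * a%:Z + j%:Z * d%:Z by ring.
rewrite !arith_semigroup_residue // (bigD1 (Ordinal ja)) //= big1 ?addr0.
  have -> : (t * a%:Z + j%:Z * d%:Z == apery a d k j) = (t == (ceil_div j k)%:Z).
    rewrite /apery PoszD !PoszM (inj_eq (@addIr _ _)) (inj_eq (mulIf _)) //; lia.
  by case: ltgtP => h; do ?case: leP => ?; lia.
(* Only the index of the residue class of [x] can contribute. *)
move=> i /eqP ij; case: eqP => // e; case: ij; apply/val_inj => /=.
exact: (@residue_uniq _ _ (ceil_div i k)%:Z t).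
Qed.

Lemma hilbert_numerator (x : int) :
  let chi y : int := (y \in arith_semigroup a d k)%:R in
  let c := (a + k * d)%N%:Z in
  chi x - chi (x - a%:Z) - chi (x - c) + chi (x - (a%:Z + c)) =
  \sum_(0 <= j < k) (x == apery a d k j)%:R
  - \sum_(a <= j < a + k) (x == apery a d k j)%:R.
Proof.
move=> chi c; rewrite [a%:Z + c]addrC.
have -> : chi x - chi (x - a%:Z) - chi (x - c) + chi (x - (c + a%:Z))
   = (chi x - chi (x - a%:Z)) - (chi (x - c) - chi (x - c - a%:Z)).
  rewrite opprD !addrA; ring.
rewrite /chi !arith_semigroup_apery -!(big_mkord xpredT (fun j => (_ == apery a d k j)%:R)).
have -> : \sum_(0 <= j < a) (x - c == apery a d k j)%:R
    = \sum_(k <= j < a + k) (x == apery a d k j)%:R :> int.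
  rewrite -{2}[k]add0n big_addn addnK; apply: eq_bigr => j _.
  by rewrite addnC -[X in (X + _)%N]mul1n aperyD // mul1r subr_eq.
(* With the negative sums moved across, both sides are the sum over [0 <= j < a + k], cut at [a] and
   at [k] respectively. *)
apply/eqP; rewrite subr_eq addrAC eq_sym subr_eq; apply/eqP.
by rewrite -!big_cat_nat ?leq_addr ?leq_addl.
Qed.

End Residue.

(** * The reduced Moebius function as a convolution inverse *)

Lemma rmoebius_notin (a d k : nat) (x : int) :
  x \notin arith_semigroup a d k -> rmoebius (arith_semigroup a d k) x = 0.
Proof.
move=> xS; apply: moebius_nle; first exact: arith_semigroup0.
by rewrite /leS subr0.
Qed.

(** Coefficient form of the inversion of [H_S]. The bound [N] only truncates: for [z >= N] the
    difference [x - z] is negative, hence outside [S]. *)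
Lemma rmoebius_conv (a d k N : nat) (x : int) : x < N%:Z ->
  \sum_(0 <= z < N) rmoebius (arith_semigroup a d k) z%:Z
    * (x - z%:Z \in arith_semigroup a d k)%:R = (x == 0)%:R.
Proof.
set S := arith_semigroup a d k => xN.
have S_ge0 y : y \in S -> 0 <= y by rewrite inE => /arith_semigroup_ge0.
have [xS|xS] := boolP (x \in S); last first.
  have -> : (x == 0) = false.
    by apply: contraNF xS => /eqP ->; rewrite inE; exact: arith_semigroup0.
  apply: big1 => z _; have [zS|/rmoebius_notin ->] := boolP (z%:Z \in S).
    case: (boolP (x - _ \in S)) => [xzS|]; last by rewrite mulr0.
    case/negP: xS; rewrite -[x](subrK z%:Z) inE.
    by apply: arith_semigroupD; rewrite -inE.
  by rewrite mul0r.
have x_ge0 := S_ge0 _ xS.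
have [n xE] : exists n : nat, x = n%:Z by exists `|x|%N; lia.
subst x; rewrite (bigD1_seq n) ?iota_uniq ?mem_index_iota //=.
rewrite subrr [0 \in S]mem_set ?mulr1; last exact: arith_semigroup0.
have [n0|n0] := eqVneq n%:Z 0.
  rewrite n0 {1}/rmoebius moebius_refl big1 ?addr0 // => z zn.
  by case: (boolP (_ \in S)) => [/S_ge0|]; [lia|rewrite mulr0].
rewrite {1}/rmoebius moebius_lt; first last.
- by rewrite /ltS /leS subr0 xS eq_sym.
- exact: arith_semigroup_ge0.
apply/eqP; rewrite addrC subr_eq0; apply/eqP.
(* The term [z = n] is [mu n]; the others must match the finitely supported sum defining [- mu n].
   Outside the poset interval either [mu z] or the indicator of [n - z] vanishes. *)
rewrite -big_filter.
rewrite -(big_map Posz xpredT (fun z : int => rmoebius S z * (n%:Z - z \in S)%:R)).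
rewrite -(fsbig_fwiden _ [set z | leS S 0 z && ltS S z n%:Z]%classic).
- apply: eq_fsbigr => z; rewrite inE /= => /andP[_ /andP[zn _]].
  by rewrite -/(leS S z n) zn mulr1.
- move=> z /= /andP[]; rewrite /ltS /leS subr0 => /S_ge0 z_ge0 /andP[/S_ge0 zn z_neq].
  by apply/mapP; exists `|z|%N; rewrite ?mem_filter ?mem_index_iota; lia.
- by rewrite map_inj_uniq ?filter_uniq ?iota_uniq // => ? ? [].
- move=> z /= [/mapP[m]]; rewrite mem_filter => /andP[mn _] -> {z}.
  rewrite /ltS /leS subr0 => /negP; rewrite eqz_nat mn andbT negb_and.
  by case/orP => [/rmoebius_notin ->|/negbTE ->]; rewrite ?mul0r ?mulr0.
Qed.

Lemma rmoebius_pick (a d k N : nat) (x : int) : x < N%:Z ->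
  \sum_(0 <= z < N) rmoebius (arith_semigroup a d k) z%:Z * (x == z%:Z)%:R
  = rmoebius (arith_semigroup a d k) x.
Proof.
move=> xN; case: x xN => n nN; last first.
  rewrite rmoebius_notin; first by apply: big1 => z _; rewrite mulr0.
  by apply/negP; rewrite inE => /arith_semigroup_ge0.
rewrite (bigD1_seq n) ?iota_uniq ?mem_index_iota //= eqxx mulr1.
by rewrite big1 ?addr0 // => z /negbTE; rewrite eqz_nat eq_sym => ->; rewrite mulr0.
Qed.

(** Convolving [hilbert_numerator] with [mu] turns its right side into the difference of these sums
    and its left side into four point masses, at the excluded values of [x]. *)
Lemma rmoebius_apery (a d k : nat) (x : int) :
  (0 < a)%N -> (0 < k)%N -> coprime a d ->
  x \notin [:: 0; a%:Z; (a + k * d)%N%:Z; (a + (a + k * d))%N%:Z] ->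
  let mu := rmoebius (arith_semigroup a d k) in
  \sum_(0 <= j < k) mu (x - apery a d k j)
  = \sum_(a <= j < a + k) mu (x - apery a d k j).
Proof.
move=> a_gt0 k_gt0 cop; rewrite !inE !negb_or => /and4P[x0 xa xc xac] mu.
have [N xN] : exists N : nat, forall c : nat, x - c%:Z < N%:Z.
  by exists `|x|.+1 => c; lia.
apply/eqP; rewrite -subr_eq0; apply/eqP.
pose chi y : int := (y \in arith_semigroup a d k)%:R.
pose c := (a + k * d)%N%:Z.
transitivity (\sum_(0 <= z < N) mu z%:Z * (chi (x - z%:Z) - chi (x - z%:Z - a%:Z)
    - chi (x - z%:Z - c) + chi (x - z%:Z - (a%:Z + c)))).
  have pick m n : \sum_(m <= j < n) mu (x - apery a d k j) =
     \sum_(0 <= z < N) mu z%:Z * \sum_(m <= j < n) (x - z%:Z == apery a d k j)%:R.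
    under [RHS]eq_bigr do rewrite big_distrr /=.
    rewrite exchange_big /=; apply: eq_bigr => j _.
    rewrite -[LHS](rmoebius_pick _ _ _ _ _ (xN _)); apply: eq_bigr => z _.
    by rewrite !subr_eq addrC.
  rewrite !pick -sumrB; apply: eq_bigr => z _.
  by rewrite -mulrBr hilbert_numerator.
have conv (b : nat) : x != b%:Z ->
    \sum_(0 <= z < N) mu z%:Z * chi (x - z%:Z - b%:Z) = 0.
  move=> xb; under eq_bigr do rewrite addrAC.
  by rewrite rmoebius_conv // subr_eq0 (negbTE xb).
(* The unshifted term is written as a shift by 0, so that [conv] covers all four. *)
under eq_bigr => z _ do rewrite mulrDr !mulrBr -{1}[x - z%:Z]subr0.
by rewrite big_split !sumrB /= (conv 0%N) // !conv // !subr0 addr0.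
Qed.

(** * The recurrences, by the value of [r] *)

Theorem theorem5p1 (a d k : nat) (q : int) (r : nat) (x : int)
  (a_gt0 : (0 < a)%N) (d_gt0 : (0 < d)%N) (coprime_ad : coprime a d)
  (k_ge1 : (1 <= k)%N) (k_le : (k <= a - 1)%N)
  (a_eq : a%:Z = q * k%:Z + r%:Z) (r_lt : (r < k)%N)
  (x_neq : x \notin [:: 0; a%:Z; (a + k * d)%N%:Z; (a + (a + k * d))%N%:Z]) :
  let mu := rmoebius (arith_semigroup a d k) in
  let g (i : nat) : int := (a + i * d)%N%:Z in
  [/\ r = 0%N ->
        mu x = mu (x - q * g k)
             + \sum_(1 <= i < k) (mu (x - g i - q * g k) - mu (x - g i)),
      r = 1%N ->
        mu x = mu (x - (q + 1) * g k)
             + \sum_(r <= i < k) mu (x - g i - q * g k)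
             - \sum_(1 <= i < k) mu (x - g i)
    & (2 <= r)%N ->
        mu x = mu (x - (q + 1) * g k)
             + \sum_(1 <= i < r) mu (x - g i - (q + 1) * g k)
             + \sum_(r <= i < k) mu (x - g i - q * g k)
             - \sum_(1 <= i < k) mu (x - g i)].
Proof.
move=> mu g.
(* Nonnegativity of [q] follows from [q * k = a - r > - k]. *)
have [m qm] : exists m : nat, q = m%:Z by exists `|q|%N; nia.
subst q; have am : a = (m * k + r)%N by lia.
have gen (y : int) (u v : nat) : (0 < u)%N -> (v <= k)%N ->
    \sum_(u <= i < v) mu (y - apery a d k i) = \sum_(u <= i < v) mu (y - g i).
  move=> u0 vk; apply: eq_big_nat => i /andP[ui iv].
  by rewrite apery_gen // (leq_trans u0 ui) ltnW // (leq_trans iv).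
have head (y : int) (v : nat) : (0 < v <= k)%N ->
    \sum_(0 <= i < v) mu (y - apery a d k i) = mu y + \sum_(1 <= i < v) mu (y - g i).
  by case/andP=> v0 vk; rewrite big_ltn // apery0 // subr0 gen.
have swap (y : int) (u v : nat) :
    \sum_(u <= i < v) mu (x - y - g i) = \sum_(u <= i < v) mu (x - g i - y).
  by apply: eq_bigr => i _; rewrite addrAC.
have shift (p u v : nat) :
    \sum_(p * k + u <= j < p * k + v) mu (x - apery a d k j)
    = \sum_(u <= j < v) mu (x - p%:Z * g k - apery a d k j).
  rewrite [(p * k + u)%N]addnC big_addn addKn.
  by apply: eq_bigr => j _; rewrite addnC aperyD // opprD addrA addrAC.
have := rmoebius_apery _ _ _ _ a_gt0 k_ge1 coprime_ad x_neq; cbv zeta; rewrite -/mu.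
(* The range starting at [a] lies [m] blocks of length [k] further on, and each block shifts the
   argument by [g k]. *)
have -> : index_iota a (a + k) = index_iota (m * k + r) (m * k + (r + k)).
  by rewrite addnA -am.
rewrite head ?k_ge1 ?leqnn // shift => /(canRL (addrK _)) ->.
have tail : (0 < r)%N -> \sum_(r <= j < r + k) mu (x - m%:Z * g k - apery a d k j)
    = mu (x - (m%:Z + 1) * g k) + \sum_(1 <= i < r) mu (x - g i - (m%:Z + 1) * g k)
    + \sum_(r <= i < k) mu (x - g i - m%:Z * g k).
  (* Indices from [k] on belong to the next block: they become [0 <= i < r] with shift
     [(m + 1) * g k], and index 0 gives the isolated term. *)
  move=> r0; rewrite (big_cat_nat (n := k)) ?(ltnW r_lt) ?leq_addl //=.
  rewrite [X in X + _]gen // swap addrC; congr (_ + _).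
  rewrite -swap -head ?r0 ?(ltnW r_lt) // -shift.
  have -> : m%:Z + 1 = m.+1%:Z by lia.
  rewrite -shift; congr (\sum_(_ <= _ < _) _); lia.
split=> hr.
(* For [r = 0] the range is exactly one block, so index 0 occurs with shift [m * g k]. *)
- subst r; rewrite add0n head ?k_ge1 ?leqnn // swap sumrB; ring.
- by rewrite tail ?hr // [\sum_(1 <= i < 1) _]big_geq // addr0.
- by rewrite tail // ltnW.
Qed.
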